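(* Let $Q$ be a polygonal region and $r>0$, and let $\hat{\varepsilon}:=\inf\{\varepsilon\mid\textsc{Decide}(Q,r,\varepsilon)\text{ returns YES}\}$. Let $\varepsilon>\hat{\varepsilon}$ and $0<\delta<\frac{\varepsilon-\hat{\varepsilon}}{2}$. Then $\textsc{ApproxDecideInterior}(Q,r,\varepsilon,\delta)$ returns YES.
   Context: A polygonal region is a (closed) set whose boundary consists of finitely many line segments with disjoint interiors; the input $Q$ is bounded. $D_s(c)$ is the closed disk of radius $s$ around $c$, $D_s:=D_s(0)$, $X^C:=\mathbb{R}^2\setminus X$, $\oplus$ is Minkowski sum, $\mathrm{offset}(X,s):=X\oplus D_s$, $\mathrm{inset}(X,s):=\mathrm{offset}(X^C,s)^C=\{x\mid D_s(x)\subseteq X\}$. $\textsc{Decide}(Q,r,\varepsilon)$ (for $\varepsilon>0$): $Q_\varepsilon:=\mathrm{offset}(Q,\varepsilon)$, $\Pi:=\mathrm{inset}(Q_\varepsilon,r)$, $Q':=\mathrm{offset}(\Pi,r+\varepsilon)$; return YES if $Q\subseteq Q'$, else NO. (For $\varepsilon\ge r$ it returns YES, so $\hat\varepsilon\in[0,r]$.) For $0\le a<b$, $\bar{D}_{a,b}$ denotes a polygon with rational vertices whose boundary lies in the annulus between the circles of radii $a$ and $b$ around the origin, so that $D_a\subseteq\bar{D}_{a,b}\subseteq D_b$. $\textsc{ApproxDecideInterior}(Q,r,\varepsilon,\delta)$: (1) $\widehat{Q_\varepsilon}:=Q\oplus\widehat{D_\varepsilon}$ with $\widehat{D_\varepsilon}:=\bar{D}_{\varepsilon-\delta,\varepsilon}$;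 (2) $\widehat{\Pi}:=(\widehat{Q_\varepsilon}^C\oplus\widehat{D_r})^C$ with $\widehat{D_r}:=\bar{D}_{r,r+\delta}$; (3) $\widehat{Q'}:=\widehat{\Pi}\oplus\widehat{D_{r+\varepsilon}}$ with $\widehat{D_{r+\varepsilon}}:=\bar{D}_{r+\varepsilon-\delta,r+\varepsilon}$; (4) return YES if $Q\subseteq\widehat{Q'}$, otherwise UNDECIDED. *)

(* Defs.v *)
(* The plane is R * R with its product topology. *)
From HB Require Import structures.
From mathcomp Require Import all_boot all_order all_algebra.
From mathcomp Require Import all_classical all_reals all_analysis.

Set Implicit Arguments.
Unset Strict Implicit.
Unset Printing Implicit Defensive.

Import Order.TTheory GRing.Theory Num.Theory.
Import numFieldNormedType.Exports.

Local Open Scope classical_set_scope.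
Local Open Scope ring_scope.

Section plane_geometry.
Context {R : realType}.
Local Notation plane := (R * R)%type.
Implicit Types (A B P Q X : set plane) (c x : plane) (r s eps : R).

(* The library norm of R * R is the sup norm. *)
Definition enorm x : R := Num.sqrt (x.1 ^+ 2 + x.2 ^+ 2).

Definition disk c s : set plane := [set x | enorm (x - c) <= s].

Definition minkowski_sum A B : set plane := [set x + y | x in A & y in B].

Definition offset X s := minkowski_sum X (disk 0 s).

Definition inset X s := ~` offset (~` X) s.

Lemma insetE X s : inset X s = [set x | disk x s `<=` X].
Proof.
have enormN x : enorm (- x) = enorm x by rewrite /enorm /= !sqrrN.
apply/seteqP; split=> x /=.
- move=> nx y xy; apply: contrapT => nXy; apply: nx.
  exists y => //; exists (x - y); last by rewrite addrC subrK.
  by rewrite /disk /= subr0 -enormN opprB.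
- move=> dX [y nXy] [z]; rewrite /disk /= subr0 => zs yzx; apply: nXy.
  by apply: dX; rewrite /disk /= -yzx opprD addrA subrr add0r enormN.
Qed.

Definition frontier A := closure A `\` A°.

(* A pair of points stands for the line segment with these end points. *)
Definition segment (e : plane * plane) : set plane :=
  [set (1 - t) *: e.1 + t *: e.2 | t in [set t : R | 0 <= t <= 1]].

Definition open_segment (e : plane * plane) : set plane :=
  [set (1 - t) *: e.1 + t *: e.2 | t in [set t : R | 0 < t < 1]].

Definition polygonal_region A :=
  closed A /\
  exists E : seq (plane * plane),
    [/\ uniq E,
        forall e, e \in E -> e.1 != e.2,
        forall e e', e \in E -> e' \in E -> e != e' ->
          open_segment e `&` open_segment e' = set0 &
        frontier A = \bigcup_(e in [set` E]) segment e].

Definition cyclic_edges (vs : seq plane) : seq (plane * plane) :=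
  zip vs (rot 1 vs).

(* Distinct edges meet at most in common end points; since the vertices are
   distinct, this makes the union of the edges a Jordan curve. *)
Definition simple_closed_chain (vs : seq plane) :=
  [/\ (2 < size vs)%N, uniq vs &
      forall e e', e \in cyclic_edges vs -> e' \in cyclic_edges vs -> e != e' ->
        segment e `&` segment e' `<=` [set e.1; e.2] `&` [set e'.1; e'.2]].

(* A bounded regular closed set whose boundary is a Jordan curve is that curve
   together with the domain it encloses. *)
Definition polygon (vs : seq plane) P :=
  [/\ simple_closed_chain vs, bounded_set P, P = closure P° &
      frontier P = \bigcup_(e in [set` cyclic_edges vs]) segment e].

Definition rational_point (v : rat * rat) : plane := (ratr v.1, ratr v.2).

Definition disk_polygon (a b : R) P :=
  [/\ exists vs : seq (rat * rat), polygon (map rational_point vs) P,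
      frontier P `<=` [set x | a <= enorm x <= b],
      disk 0 a `<=` P &
      P `<=` disk 0 b].

Inductive answer := YES | NO | UNDECIDED.

Definition decide Q r eps : answer :=
  let Qeps := offset Q eps in
  let Pi := inset Qeps r in
  let Q' := offset Pi (r + eps) in
  if `[< Q `<=` Q' >] then YES else NO.

Definition critical_eps Q r : R :=
  inf [set eps | 0 < eps /\ decide Q r eps = YES].

(* The polygons Deps, Dr, Dreps approximating the disks of radii eps, r and
   r + eps are not determined by the algorithm: they are arguments here, to be
   constrained by disk_polygon. *)
Definition approx_decide_interior Q (Deps Dr Dreps : set plane) : answer :=
  let Qeps := minkowski_sum Q Deps in
  let Pi := ~` minkowski_sum (~` Qeps) Dr in
  let Q' := minkowski_sum Pi Dreps in
  if `[< Q `<=` Q' >] then YES else UNDECIDED.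

End plane_geometry.

(* Main.v *)
(* If Decide answers YES for some e < eps - 2 * delta, then a centre p witnessing
   this for a point q of Q also witnesses it in the approximate algorithm:
   replacing the disk of radius r by one of radius r + delta moves points by at
   most delta, so disk p (r + delta) lies in offset Q (e + delta), and
   e + delta <= eps - delta. *)
Require Import Defs.
From HB Require Import structures.
From mathcomp Require Import all_boot all_order all_algebra.
From mathcomp Require Import all_classical all_reals all_analysis.
From mathcomp Require Import ring lra.

Set Implicit Arguments.
Unset Strict Implicit.
Unset Printing Implicit Defensive.

Import Order.TTheory GRing.Theory Num.Theory.
Import numFieldNormedType.Exports.

Local Open Scope classical_set_scope.
Local Open Scope ring_scope.

Lemma enorm_ge0 (R : realType) (x : R * R) : 0 <= enorm x.
Proof. exact: sqrtr_ge0. Qed.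

Lemma enorm_sqr (R : realType) (x : R * R) :
  enorm x ^+ 2 = x.1 ^+ 2 + x.2 ^+ 2.
Proof. by rewrite sqr_sqrtr // addr_ge0 // sqr_ge0. Qed.

Lemma enormZ (R : realType) (k : R) (x : R * R) :
  enorm (k *: x) = `|k| * enorm x.
Proof.
rewrite /enorm /= -(sqrtr_sqr k) -sqrtrM ?sqr_ge0 //.
by congr Num.sqrt; rewrite /GRing.scale /=; ring.
Qed.

Lemma enormD (R : realType) (x y : R * R) : enorm (x + y) <= enorm x + enorm y.
Proof.
have nx := enorm_ge0 x; have ny := enorm_ge0 y.
rewrite -ler_sqr ?nnegrE ?enorm_ge0 ?addr_ge0 //.
suff cs : x.1 * y.1 + x.2 * y.2 <= enorm x * enorm y.
  by rewrite sqrrD !enorm_sqr /=; lra.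
apply: (le_trans (ler_norm _)).
rewrite -ler_sqr ?nnegrE ?mulr_ge0 // exprMn !enorm_sqr real_normK ?num_real //.
(* Lagrange's identity: this square is the gap between the two sides of the squared Cauchy-Schwarz
   inequality. *)
have := sqr_ge0 (x.1 * y.2 - x.2 * y.1); lra.
Qed.

Lemma disk0E (R : realType) (x : R * R) (s : R) :
  disk 0 s x = (enorm x <= s) :> Prop.
Proof. by rewrite /disk /= subr0. Qed.

Lemma disk0N (R : realType) (x : R * R) (s : R) : disk 0 s x -> disk 0 s (- x).
Proof. by rewrite !disk0E -scaleN1r enormZ normrN1 mul1r. Qed.

Lemma minkowski_sumS (R : realType) (A A' B B' : set (R * R)) :
  A `<=` A' -> B `<=` B' -> minkowski_sum A B `<=` minkowski_sum A' B'.
Proof.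
move=> AA' BB' _ [a Aa [b Bb <-]].
by exists a; [exact: AA'|exists b => //; exact: BB'].
Qed.

Lemma disk0S (R : realType) (s t : R) :
  s <= t -> disk (0 : R * R) s `<=` disk 0 t.
Proof. by move=> st x; rewrite !disk0E => /le_trans; apply. Qed.

(** A vector is split along itself in the proportion [s : t]; [0 < s] keeps the denominator [s + t]
    positive. *)
Lemma disk0D (R : realType) (s t : R) : 0 < s -> 0 <= t ->
  disk (0 : R * R) (s + t) `<=` minkowski_sum (disk 0 s) (disk 0 t).
Proof.
move=> s0 t0 x; rewrite disk0E => xst.
have st0 : 0 < s + t by lra.
have shrink (k : R) : 0 <= k -> disk 0 k ((k / (s + t)) *: x).
  move=> k0; rewrite disk0E enormZ ger0_norm ?divr_ge0 ?(ltW st0) //.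
  by rewrite mulrAC ler_pdivrMr // ler_wpM2l.
exists ((s / (s + t)) *: x); first exact/shrink/ltW.
exists ((t / (s + t)) *: x); first exact: shrink.
by rewrite -scalerDl -mulrDl divff ?scale1r // gt_eqF.
Qed.

Lemma offsetD (R : realType) (X : set (R * R)) (s t : R) :
  offset (offset X s) t `<=` offset X (s + t).
Proof.
move=> _ [_ [x Xx [u us <-]] [v vt <-]].
exists x => //; exists (u + v); last by rewrite addrA.
move: us vt; rewrite !disk0E => us vt.
by rewrite (le_trans (enormD u v)) // lerD.
Qed.

(** If [y] is within [r + delta] of [p], then some [y + v] is within [r] of [p] and within [delta]
    of [y]. It lies in [offset X e], so [y] lies in [offset X (e + delta)]. *)
Lemma inset_offset (R : realType) (X : set (R * R)) (r e delta : R) :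
  0 < r -> 0 <= delta ->
  inset (offset X e) r `<=` inset (offset X (e + delta)) (r + delta).
Proof.
move=> r0 d0 p pin [y nXy [_ /(disk0D r0 d0)[u ur [v vd <-]] pE]].
apply: nXy; apply: offsetD; exists (y + v).
  by apply: contrapT => nX; apply: pin; exists (y + v) => //; exists u;
    rewrite // -pE addrAC addrA.
by exists (- v); [exact: disk0N|rewrite addrK].
Qed.

Lemma decideP (R : realType) (Q : set (R * R)) (r e : R) :
  decide Q r e = YES <-> Q `<=` offset (inset (offset Q e) r) (r + e).
Proof. by rewrite /decide; case: asboolP. Qed.

(** Every point of [Q] is its own centre. This makes the set under the infimum in [critical_eps]
    nonempty. *)
Lemma decide_radius (R : realType) (Q : set (R * R)) (r : R) :
  0 < r -> decide Q r r = YES.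
Proof.
move=> r0; apply/decideP => q Qq; exists q; last first.
  exists 0; rewrite ?addr0 // disk0E -(scale0r 0) enormZ normr0 mul0r; lra.
move=> [y nQy [u ur yuq]]; apply: nQy; exists q => //; exists (- u).
  exact: disk0N.
by rewrite -yuq addrK.
Qed.

Lemma decide_below (R : realType) (Q : set (R * R)) (r t : R) :
  0 < r -> critical_eps Q r < t -> exists2 e, e < t & decide Q r e = YES.
Proof.
move=> r0; rewrite -subr_gt0.
(* The set contains [r] and is bounded below by 0, so [inf] is a true infimum and not a default
   value; the slack is [t - critical_eps Q r]. *)
move=> /(@inf_adherent R [set e | 0 < e /\ decide Q r e = YES])[].
  split; first by exists r; split => //; exact: decide_radius.
  by exists 0 => e [/ltW].
by move=> e [_ eY]; rewrite addrC subrK; exists e.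
Qed.

Theorem theorem11 (R : realType) (Q : set (R * R)) (r eps delta : R)
    (Deps Dr Dreps : set (R * R)) :
  polygonal_region Q -> bounded_set Q ->
  0 < r ->
  critical_eps Q r < eps ->
  0 < delta < (eps - critical_eps Q r) / 2 ->
  disk_polygon (eps - delta) eps Deps ->
  disk_polygon r (r + delta) Dr ->
  disk_polygon (r + eps - delta) (r + eps) Dreps ->
  approx_decide_interior Q Deps Dr Dreps = YES.
Proof.
move=> _ _ r0 _ /andP[d0 dlt] [_ _ DepsI _] [_ _ _ DrO] [_ _ DrepsI _].
(* The bound on [delta] says exactly that [eps - 2 * delta] exceeds the critical value. *)
have [|e elt /decideP QQ'] := @decide_below R Q r (eps - 2 * delta) r0; first lra.
rewrite /approx_decide_interior asboolT //.
apply: (subset_trans QQ'); apply: minkowski_sumS; last first.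
  (* Here [r + e <= r + eps - delta]. *)
  by apply: subset_trans DrepsI; apply: disk0S; lra.
apply: (subset_trans (inset_offset r0 (ltW d0))).
(* Complements reverse inclusions: [Dr] is bounded from outside, whereas [Deps] and [Dreps] are
   bounded from inside. *)
apply: subsetC; apply: minkowski_sumS DrO; apply: subsetC.
apply: minkowski_sumS => //.
by apply: subset_trans DepsI; apply: disk0S; lra.
Qed.
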